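(* Let $X\subseteq\mathbb{R}^d$ be a closed UPC set (not necessarily simple or definable), let $\alpha$ be a UPC-index of $X$, and let $p(\alpha):=\lceil 2/\alpha\rceil$. Let $x\in X$, let $n\in\mathbb{N}$, and let $\omega$ be a modulus of continuity. Assume that $f\in\mathcal{A}^{np(\alpha),\omega}(X)\cap\mathcal{C}^n(X)$ is weakly $\frac{np(\alpha)}{2}$-flat at $x$ in $X$. Then $f$ is $n$-flat at $x$, i.e., $f^{(j)}(x)=0$ for all $j\le n$.
   Context: $\mathbb{N}=\{0,1,2,\dots\}$; $X^\circ$ is the interior of $X$. A closed set $X\subseteq\mathbb{R}^d$ is UPC (uniformly polynomially cuspidal) if there exist positive constants $M,m$ and a positive integer $N$ such that for each $x\in X$ there is a polynomial curve $h_x:\mathbb{R}\to\mathbb{R}^d$ of degree at most $N$ with $h_x(0)=x$ and $\operatorname{dist}(h_x(t),\mathbb{R}^d\setminus X)\ge M t^m$ for all $t\in[0,1]$. One may assume that $m$ is a positive integer; then $\alpha=\frac1m$ is called a UPC-index of $X$. A UPC set is fat, i.e., $X=\overline{X^\circ}$. For $r\ge0$, a function $f:X\to\mathbb{R}$ is weakly $r$-flat at $x$ in $X$ if $|f(y)|/|y-x|^r\to0$ as $X\ni y\to x$. $\mathcal{C}^n(X)$ is the set of $f:X\to\mathbb{R}$ such that $f|_{X^\circ}\in\mathcal{C}^n(X^\circ)$ and all Fréchet derivatives $(f|_{X^\circ})^{(j)}$, $j\le n$, extend continuously to maps $f^{(j)}:X\to L^j(\mathbb{R}^d,\mathbb{R})$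 ($j$-linear maps), with $f^{(0)}=f$. A modulus of continuity is an increasing subadditive function $\omega:[0,\infty)\to[0,\infty)$ with $\lim_{t\to0}\omega(t)=0$. $\mathcal{C}^{k,\omega}(\mathbb{R},\mathbb{R})$ is the set of $k$-times continuously differentiable $g:\mathbb{R}\to\mathbb{R}$ such that for each compact $K\subseteq\mathbb{R}$ there is $C>0$ with $|g^{(k)}(s)-g^{(k)}(t)|\le C\omega(|s-t|)$ for $s,t\in K$. $\mathcal{A}^{k,\omega}(X)$ is the set of all $f:X\to\mathbb{R}$ with $f\circ c\in\mathcal{C}^{k,\omega}(\mathbb{R},\mathbb{R})$ for all $\mathcal{C}^\infty$-curves $c:\mathbb{R}\to\mathbb{R}^d$ with $c(\mathbb{R})\subseteq X$. *)

(* Defs.v *)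
From mathcomp Require Import all_boot all_order all_algebra.
From mathcomp Require Import all_classical all_reals all_analysis.
Import Order.TTheory GRing.Theory Num.Theory.
Import numFieldNormedType.Exports.

Set Implicit Arguments.
Unset Strict Implicit.
Unset Printing Implicit Defensive.

Local Open Scope classical_set_scope.
Local Open Scope ring_scope.

(* The library norm on 'rV[R]_d is the sup norm; |.| is Euclidean here. Both
   induce the same topology, so closed, interior and nbhs are the library's. *)
Definition enorm (R : realType) (d : nat) (x : 'rV[R]_d) : R :=
  Num.sqrt (\sum_(i < d) x ord0 i ^+ 2).

(* Extended-real valued, so that the distance to the empty set is +oo. *)
Definition edistance (R : realType) (d : nat) (x : 'rV[R]_d)
    (A : set 'rV[R]_d) : \bar R :=
  ereal_inf [set (enorm (x - y))%:E | y in A].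

Definition poly_curve (R : realType) (d : nat) (h : 'I_d -> {poly R}) (t : R) :
    'rV[R]_d :=
  \row_(i < d) (h i).[t].

(* The cusp condition with a given exponent m, a positive real. *)
Definition UPC_exponent (R : realType) (d : nat) (X : set 'rV[R]_d) (m : R) :
    Prop :=
  exists (M : R) (N : nat), [/\ 0 < M, (0 < N)%N &
    forall x, X x -> exists h : 'I_d -> {poly R},
      [/\ forall i, (size (h i) <= N.+1)%N,
          poly_curve h 0 = x &
          forall t : R, 0 <= t <= 1 ->
            ((M * t `^ m)%:E <= edistance (poly_curve h t) (~` X))%E]].

Definition UPC (R : realType) (d : nat) (X : set 'rV[R]_d) : Prop :=
  closed X /\ exists m : R, 0 < m /\ UPC_exponent X m.

Definition UPC_index (R : realType) (d : nat) (X : set 'rV[R]_d) (alpha : R) :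
    Prop :=
  exists m : nat, [/\ (0 < m)%N, alpha = m%:R^-1 & UPC_exponent X m%:R].

(* The absolute value only serves to read a nonnegative integer as a nat. *)
Definition p_index (R : realType) (alpha : R) : nat :=
  `|Num.ceil (2 / alpha)|%N.

(* A function X -> R is represented by a function on the whole space; all the
   notions below depend only on its values on X. *)
Definition weakly_flat (R : realType) (d : nat) (X : set 'rV[R]_d) (r : R)
    (f : 'rV[R]_d -> R) (x : 'rV[R]_d) : Prop :=
  `|f y| / enorm (y - x) `^ r @[y --> within X x^'] --> (0 : R).

Definition multilinear (R : realType) (d j : nat)
    (T : ('I_j -> 'rV[R]_d) -> R) : Prop :=
  forall (v : 'I_j -> 'rV[R]_d) (i : 'I_j) (a : R) (u w : 'rV[R]_d),
    T (dfwith v i (a *: u + w)) = a * T (dfwith v i u) + T (dfwith v i w).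

Definition opnorm_le (R : realType) (d j : nat)
    (T : ('I_j -> 'rV[R]_d) -> R) (c : R) : Prop :=
  forall v, `|T v| <= c * \prod_(i < j) enorm (v i).

Definition vcons (R : realType) (d j : nat) (h : 'rV[R]_d)
    (v : 'I_j -> 'rV[R]_d) : 'I_j.+1 -> 'rV[R]_d :=
  fun i => oapp v h (unlift ord0 i).

(* T, with values in the j-linear forms under the operator norm, is Frechet
   differentiable at x; its derivative, a linear map into the j-linear forms,
   is identified with the (j+1)-linear form L whose first slot is the
   increment. *)
Definition frechet_derivative_at (R : realType) (d j : nat)
    (T : 'rV[R]_d -> ('I_j -> 'rV[R]_d) -> R) (x : 'rV[R]_d)
    (L : ('I_j.+1 -> 'rV[R]_d) -> R) : Prop :=
  forall e : R, 0 < e -> \forall y \near x,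
    opnorm_le (fun v => T y v - T x v - L (vcons (y - x) v))
              (e * enorm (y - x)).

(* F j = f^(j) for j <= n : on the interior of X these are the successive
   Frechet derivatives of f, and each is continuous on X. Only the values
   F j x with j <= n and x in X are constrained. *)
Definition extended_derivatives (R : realType) (d : nat) (X : set 'rV[R]_d)
    (n : nat) (f : 'rV[R]_d -> R)
    (F : forall j : nat, 'rV[R]_d -> ('I_j -> 'rV[R]_d) -> R) : Prop :=
  [/\ forall x v, X x -> F 0%N x v = f x,
      forall j x, (j <= n)%N -> X x -> multilinear (F j x),
      forall j x, (j < n)%N -> X° x ->
        frechet_derivative_at (F j) x (F j.+1 x) &
      forall j x, (j <= n)%N -> X x -> forall e : R, 0 < e ->
        \forall y \near within X (nbhs x),
          opnorm_le (fun v => F j y v - F j x v) e].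

Definition Cn (R : realType) (d : nat) (X : set 'rV[R]_d) (n : nat)
    (f : 'rV[R]_d -> R) : Prop :=
  exists F, extended_derivatives X n f F.

(* When X is the closure of its interior, the f^(j) are determined on X by f;
   the quantification over F only names them. Meaningful for f in Cn X n. *)
Definition flat (R : realType) (d : nat) (X : set 'rV[R]_d) (n : nat)
    (f : 'rV[R]_d -> R) (x : 'rV[R]_d) : Prop :=
  forall F, extended_derivatives X n f F ->
    forall j, (j <= n)%N -> forall v, F j x v = 0.

(* omega is only considered on [0, +oo[. *)
Definition modulus_of_continuity (R : realType) (omega : R -> R) : Prop :=
  [/\ forall t, 0 <= t -> 0 <= omega t,
      forall s t, 0 <= s -> s <= t -> omega s <= omega t,
      forall s t, 0 <= s -> 0 <= t -> omega (s + t) <= omega s + omega t &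
      omega t @[t --> 0^'+] --> (0 : R)].

Definition smooth_curve (R : realType) (d : nat) (c : R -> 'rV[R]_d) : Prop :=
  forall (k : nat) (t : R), derivable (derive1n k c) t 1.

Definition Ckomega (R : realType) (k : nat) (omega : R -> R) (g : R -> R) :
    Prop :=
  [/\ forall (j : nat) (t : R), (j < k)%N -> derivable (derive1n j g) t 1,
      continuous (derive1n k g) &
      forall K : set R, compact K -> exists2 C : R, 0 < C &
        forall s t, K s -> K t ->
          `|derive1n k g s - derive1n k g t| <= C * omega `|s - t|].

Definition Akomega (R : realType) (d : nat) (X : set 'rV[R]_d) (k : nat)
    (omega : R -> R) (f : 'rV[R]_d -> R) : Prop :=
  forall c : R -> 'rV[R]_d, smooth_curve c -> (forall t, X (c t)) ->
    Ckomega k omega (f \o c).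

(* Main.v *)
(* Let h be the polynomial curve at x, m = 1/alpha, rho = t^m. The ball of
   radius proportional to rho about h(t) lies in X and within O(t) of x, so on
   it weak flatness of order nm gives |f| = o(t^(nm)) = o(rho^n). By the mean
   value theorem, a j-fold mixed difference of f with steps proportional to
   rho v_i equals rho^j f^(j)(z)(v) up to a constant, with z in this ball;
   hence f^(j)(z)(v) = o(rho^(n - j)), and z -> x as t -> 0. For j <= n the
   continuity of f^(j) on X yields f^(j)(x) = 0. *)
Require Import Defs.
From mathcomp Require Import all_boot all_order all_algebra.
From mathcomp Require Import all_classical all_reals all_analysis.
From mathcomp Require Import zify ring lra.
Import Order.TTheory GRing.Theory Num.Theory.
Import numFieldNormedType.Exports.

Set Implicit Arguments.
Unset Strict Implicit.
Unset Printing Implicit Defensive.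

Local Open Scope classical_set_scope.
Local Open Scope ring_scope.

(** * Iterated differences and their mean value theorem *)

Section MixedDifferences.
Context {R : realType} {V : normedModType R}.
Implicit Types (us s : seq V) (g : V -> R) (a u y z : V).

Fixpoint mixed_diff us g y : R :=
  if us is u :: us' then mixed_diff us' g (y + u) - mixed_diff us' g y
  else g y.

(* Keeps every point y + sum of t_w w with t_w in [0, 1] inside the ball of
   radius r about a. *)
Definition fits a (r : R) y us : Prop :=
  `|y - a| + \sum_(w <- us) `|w| < r.

Lemma fits_nil a r y us : fits a r y us -> `|y - a| < r.
Proof. by apply: le_lt_trans; rewrite lerDl sumr_ge0. Qed.

Lemma fits_tail {a r y u us} : fits a r y (u :: us) -> fits a r y us.
Proof.
by apply: le_lt_trans; rewrite big_cons lerD2l lerDr.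
Qed.

Lemma fits_shift {a r y u us} (t : R) : 0 <= t <= 1 ->
  fits a r y (u :: us) -> fits a r (y + t *: u) us.
Proof.
move=> /andP[t0 t1]; rewrite /fits big_cons addrA; apply: le_lt_trans.
rewrite lerD2r -addrAC; apply: le_trans (ler_normD _ _) _.
by rewrite lerD2l normrZ ger0_norm// ler_piMl.
Qed.

(** The difference is a signed sum of $2^{|us|}$ values of [g] at vertices of a parallelepiped,
    which [fits] keeps in the ball. *)
Lemma mixed_diff_bound us g y a r (b : R) :
    (forall z, `|z - a| < r -> `|g z| <= b) -> fits a r y us ->
  `|mixed_diff us g y| <= 2 ^+ size us * b.
Proof.
move=> gb; elim: us y => [|u us IH] y yus /=.
  by rewrite mul1r; apply/gb/fits_nil/yus.
apply: le_trans (ler_normB _ _) _; rewrite exprS.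
have := IH _ (fits_tail yus).
have := fits_shift _ yus (t := 1); rewrite scale1r ler01 lexx => /(_ isT)/IH.
by lra.
Qed.

(** Differencing is linear and commutes with translations, hence with the derivative in direction
    [u]. *)
Lemma is_derive_mixed_diff us g (g' : V -> R) a r u y (t : R) :
    (forall z, `|z - a| < r ->
       is_derive z u g (g' z)) ->
    fits a r (y + t *: u) us ->
  is_derive t 1 (fun q : R => mixed_diff us g (y + q *: u))
    (mixed_diff us g' (y + t *: u)).
Proof.
move=> gg'; elim: us y => [|w us IH] y yus /=.
  have /gg' := fits_nil yus.
  (* The difference quotient of the restriction to the line is that of [g] in direction [u], so
     existence and value of the limit both transfer. *)
  have E : (fun h : R => h^-1 *: (((fun q : R => g (y + q *: u)) \o shift t)
      (h *: 1) - g (y + t *: u))) = (fun h : R => h^-1 *: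
      ((g \o shift (y + t *: u)) (h *: u) - g (y + t *: u))).
    apply/funext => h /=; congr (_ *: (g _ - _)).
    by rewrite [h *: 1]mulr1 scalerDl addrCA.
  by case=> dg <-; split; [rewrite /derivable E|rewrite /derive E].
have d1 := IH _ (fits_tail yus).
have := fits_shift _ yus (t := 1); rewrite scale1r ler01 lexx => /(_ isT) yw.
have {}yw : fits a r (y + w + t *: u) us by rewrite addrAC.
have d2 := IH _ yw.
rewrite (_ : (fun q : R => _) =
    (fun q : R => mixed_diff us g (y + w + q *: u)) -
    (fun q : R => mixed_diff us g (y + q *: u))); last first.
  by apply/funext => q; rewrite /= addrAC.
by rewrite (addrAC y (t *: u)); exact: is_deriveB.
Qed.

(* The derivative in the direction of the last step becomes the first slot of
   the next form, whence the reversal in [catrev]. *)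
Lemma mixed_diff_mvt {n : nat} {G : seq V -> V -> R} {a r} :
    (forall s u z, (size s < n)%N -> `|z - a| < r ->
       is_derive z u (G s) (G (u :: s) z)) ->
  forall us s y, (size us + size s <= n)%N -> fits a r y us ->
  exists2 z, `|z - a| < r & mixed_diff us (G s) y = G (catrev us s) z.
Proof.
move=> dG; elim=> [|u us IH] s y sz yus.
  by exists y => //; apply/fits_nil/yus.
(* The difference over the first step [u] is the increment from 0 to 1 of this function of [q], to
   which the one-variable mean value theorem applies. *)
have D (t : R) : 0 <= t <= 1 -> is_derive t 1
    (fun q : R => mixed_diff us (G s) (y + q *: u))
    (mixed_diff us (G (u :: s)) (y + t *: u)).
  move=> t01; apply: (is_derive_mixed_diff _ (fits_shift t01 yus)) => z za.
  by apply: dG => //; move: sz => /=; lia.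
have [t t01 E] : exists2 t : R, t \in `]0, 1[ &
    mixed_diff us (G s) (y + 1 *: u) - mixed_diff us (G s) (y + 0 *: u)
      = mixed_diff us (G (u :: s)) (y + t *: u) * (1 - 0).
  apply: (MVT (f := fun q : R => mixed_diff us (G s) (y + q *: u))).
  - exact: ltr01.
  - by move=> t; rewrite in_itv/= => /andP[t0 t1]; apply: D; rewrite !ltW.
  - apply: derivable_within_continuous => t; rewrite in_itv/= => t01.
    by have [] := D t t01.
rewrite /=; move: E; rewrite scale1r scale0r addr0 subr0 mulr1 => ->.
apply: IH; first by move: sz => /=; lia.
apply: fits_shift yus; move: t01; rewrite in_itv/= => /andP[t0 t1].
by rewrite !ltW.
Qed.

End MixedDifferences.

(** * Multilinear forms, comparison of norms, and directional derivatives *)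

Section MultilinearForms.
Context {R : realType} {d : nat}.
Local Notation V := 'rV[R]_d.

Lemma multilinear_scale_slot j (T : ('I_j -> V) -> R) v i a u :
  multilinear T -> T (dfwith v i (a *: u)) = a * T (dfwith v i u).
Proof.
move=> mT; have T0 : T (dfwith v i 0) = 0.
  by have := mT v i 1 0 0; rewrite scaler0 addr0; lra.
by rewrite -[a *: u]addr0 mT T0 addr0.
Qed.

Lemma multilinear_scale j (T : ('I_j -> V) -> R) a v :
  multilinear T -> T (fun i => a *: v i) = a ^+ j * T v.
Proof.
(* Only the first [k] arguments are scaled in [w k]; each further slot contributes one factor
   [a]. *)
move=> mT; pose w k (i : 'I_j) := if (i < k)%N then a *: v i else v i.
suff H k : (k <= j)%N -> T (w k) = a ^+ k * T v.
  by rewrite -H//; congr T; apply/funext => i; rewrite /w ltn_ord.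
elim: k => [_|k IH kj].
  by rewrite mul1r; congr T; apply/funext => i; rewrite /w ltn0.
pose i0 := Ordinal kj.
have w1 : w k.+1 = dfwith (w k) i0 (a *: v i0).
  apply/funext => i; case: dfwithP => [|i']; first by rewrite /w /= leqnn.
  by rewrite -val_eqE /w ltnS leq_eqVlt eq_sym => /negPf/= ->.
have w0 : w k = dfwith (w k) i0 (v i0).
  by apply/funext => i; case: dfwithP => //; rewrite /w /= ltnn.
by rewrite w1 multilinear_scale_slot// -w0 IH 1?ltnW// exprS mulrA.
Qed.

(** Presents the increment slot as an update, the form in which [multilinear] expresses
    linearity. *)
Lemma vcons_dfwith j (v : 'I_j -> V) h : vcons h v = dfwith (vcons h v) ord0 h.
Proof.
by apply/funext => i; case: dfwithP => //; rewrite /vcons unlift_none.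
Qed.

Lemma dfwith_vcons j (v : 'I_j -> V) h u :
  dfwith (vcons h v) ord0 u = vcons u v.
Proof.
apply/funext => i; case: dfwithP; first by rewrite /vcons unlift_none.
by move=> i'; rewrite /vcons; case: unliftP => // ->; rewrite eqxx.
Qed.

Lemma vcons_eta j (v : 'I_j.+1 -> V) : v = vcons (v ord0) (v \o lift ord0).
Proof.
by apply/funext => i; rewrite /vcons; case: unliftP => [i' ->|->].
Qed.

Definition seq_args (s : seq V) : 'I_(size s) -> V := fun i => s`_i.
Arguments seq_args : clear implicits.

Lemma seq_args_cons u s : seq_args (u :: s) = vcons u (seq_args s).
Proof.
apply/funext => i; rewrite /vcons /seq_args.
by case: unliftP => [i' ->|->] //=.
Qed.

(* Sequences avoid casts between 'I_(k + l) and 'I_j when arguments are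
   prepended one at a time. *)
Lemma args_as_seq j (v : 'I_j -> V) : exists s : seq V, [/\ size s = j,
  \sum_(w <- s) `|w| = \sum_(i < j) `|v i| &
  forall (F : forall k, V -> ('I_k -> V) -> R) z,
    F j z v = F (size s) z (seq_args s)].
Proof.
elim: j v => [|j IH] v.
  exists [::]; split => //; first by rewrite big_nil big_ord0.
  by move=> F z; congr F; apply/funext; case.
have [s [sj ss sF]] := IH (v \o lift ord0).
exists (v ord0 :: s); split; first by rewrite /= sj.
  by rewrite big_cons ss big_ord_recl.
move=> F z; rewrite seq_args_cons {1}[v]vcons_eta.
(* The tail is handled by the family with its first slot frozen at [v ord0]; this is why [F] ranges
   over all arities. *)
exact: (sF (fun k z w => F k.+1 z (vcons (v ord0) w))).
Qed.

Lemma enorm_ge0 (u : V) : 0 <= enorm u.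
Proof. exact: sqrtr_ge0. Qed.

Lemma coord_le_norm (u : V) i : `|u ord0 i| <= `|u|.
Proof.
rewrite [`|u|]mx_normrE.
by apply: (le_bigmax _ (fun ij => `|u ij.1 ij.2|) (ord0, i)).
Qed.

Lemma norm_le_coord (u : V) b :
  0 <= b -> (forall i, `|u ord0 i| <= b) -> `|u| <= b.
Proof.
move=> b0 ub; rewrite [`|u|]mx_normrE; apply: bigmax_le => // -[i j] _ /=.
by rewrite ord1.
Qed.

Lemma enorm_le_norm (u : V) : enorm u <= d%:R * `|u|.
Proof.
rewrite -[leRHS]ger0_norm ?mulr_ge0// -sqrtr_sqr ler_sqrt ?sqr_ge0// exprMn.
apply: (@le_trans _ _ (\sum_(i < d) `|u| ^+ 2)).
  apply: ler_sum => i _.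
  by rewrite -[leLHS]real_normK ?num_real// lerXn2r ?nnegrE// coord_le_norm.
rewrite sumr_const card_ord -[leLHS]mulr_natl ler_wpM2r ?sqr_ge0//.
by case: d => [|k]; rewrite expr2 ?mulr0// ler_peMl// ler1n.
Qed.

Lemma enorm_scale_le (h : R) (u : V) : enorm (h *: u) <= `|h| * d%:R * `|u|.
Proof.
by apply: le_trans (enorm_le_norm _) _; rewrite normrZ mulrCA mulrA.
Qed.

Lemma norm_le_enorm (u : V) : `|u| <= enorm u.
Proof.
apply: norm_le_coord => [|i]; first exact: enorm_ge0.
rewrite -sqrtr_sqr ler_sqrt ?sumr_ge0// => [|? _]; last exact: sqr_ge0.
by rewrite (bigD1 i)//= lerDl sumr_ge0// => ? _; exact: sqr_ge0.
Qed.

(** Along [x + h *: u] the Frechet remainder evaluated at [v] is $o(|h|)$, and linearity of [L] in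
    its first slot extracts the factor [h]. *)
Lemma frechet_is_derive j (T : V -> ('I_j -> V) -> R) x L v (u : V) :
    frechet_derivative_at T x L -> multilinear L ->
  is_derive x u (fun y => T y v) (L (vcons u v)).
Proof.
move=> dT mL; suff H : h^-1 *: (((fun y => T y v) \o shift x) (h *: u) - T x v)
    @[h --> (0 : R)^'] --> L (vcons u v).
  by split; [apply/cvg_ex; exists (L (vcons u v))|apply/cvg_lim].
apply/cvgrPdist_le => e e0.
(* [C] is the factor lost by evaluating at [u] and [v]; it may vanish, hence the division by
   [C + 1]. *)
pose C : R := d%:R * `|u| * \prod_(i < j) enorm (v i).
have C0 : 0 <= C by rewrite !mulr_ge0// prodr_ge0// => i _; exact: enorm_ge0.
have eC : 0 < e / (C + 1) by rewrite divr_gt0// ltr_wpDl.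
have : (h *: u + x) @[h --> (0 : R)^'] --> 0 *: u + x.
  apply: cvg_within_filter; apply: cvgD; last exact: cvg_cst.
  by apply: cvgZr_tmp; exact: cvg_id.
rewrite scale0r add0r => cx.
have := cx _ (dT _ eC); rewrite /= near_simpl => H.
near=> h; have h0 : h != 0 by near: h; exact: nbhs_dnbhs_neq.
have /(_ v) : opnorm_le (fun v => T (h *: u + x) v - T x v -
  L (vcons (h *: u + x - x) v)) (e / (C + 1) * enorm (h *: u + x - x)).
  by near: h.
rewrite addrK vcons_dfwith multilinear_scale_slot// dfwith_vcons.
move=> K; rewrite distrC.
have -> : h^-1 *: (T (h *: u + x) v - T x v) - L (vcons u v) =
    h^-1 * (T (h *: u + x) v - T x v - h * L (vcons u v)).
  by rewrite [RHS]mulrBr mulKf.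
rewrite normrM normfV ler_pdivrMl ?normr_gt0//; apply: le_trans K _.
have E : enorm (h *: u) * \prod_(i < j) enorm (v i) <= `|h| * C.
  rewrite /C !mulrA ler_wpM2r ?prodr_ge0// => [i _|]; first exact: enorm_ge0.
  exact: enorm_scale_le.
rewrite -[leLHS]mulrA; apply: le_trans (ler_wpM2l (ltW eC) E) _.
rewrite mulrCA ler_wpM2l// mulrAC ler_pdivrMr ?ltr_wpDl//.
by rewrite ler_wpM2l ?ltW// ltrDl.
Unshelve. all: by end_near. Qed.

End MultilinearForms.

(** * Balls inside the cusp, and estimates for [f] and its derivatives *)

Section Cusps.
Context {R : realType} {d : nat}.
Local Notation V := 'rV[R]_d.

Lemma poly_bounded01 (p : {poly R}) :
  exists2 K, 0 <= K & forall t, 0 <= t <= 1 -> `|p.[t]| <= K.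
Proof.
elim/poly_ind: p => [|p c [K K0 pK]].
  by exists 0 => // t _; rewrite horner0 normr0.
exists (K + `|c|) => [|t t01]; first by rewrite addr_ge0.
rewrite hornerMXaddC; apply: le_trans (ler_normD _ _) _.
move: (t01) => /andP[t0 t1]; rewrite lerD2r normrM (ger0_norm t0).
by apply: le_trans (pK t t01); rewrite ler_piMr.
Qed.

(** Writing $p = qX + c$ gives $p(t) - p(0) = t\,q(t)$, with $q$ bounded on $[0,1]$. *)
Lemma poly_lipschitz01 (p : {poly R}) :
  exists2 K, 0 <= K & forall t, 0 <= t <= 1 -> `|p.[t] - p.[0]| <= K * t.
Proof.
elim/poly_ind: p => [|p c _].
  by exists 0 => // t _; rewrite !horner0 subrr normr0 mul0r.
have [K K0 pK] := poly_bounded01 p; exists K => // t t01.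
rewrite !hornerMXaddC mulr0 add0r addrK normrM.
by move: (t01) => /andP[t0 _]; rewrite (ger0_norm t0) ler_wpM2r// pK.
Qed.

(** The centre is $h_x(t)$. Dividing [M] by [d] turns the Euclidean distance bound into a sup-norm
    ball inside [X]. *)
Lemma UPC_cusp (X : set V) (m : nat) (x : V) : (0 < d)%N -> (0 < m)%N ->
    UPC_exponent X m%:R -> X x ->
  exists r K : R, [/\ 0 < r, 0 < K & forall t, 0 < t <= 1 ->
    exists a : V, forall p, `|p - a| < r * t ^+ m ->
      X° p /\ `|p - x| <= K * t].
Proof.
move=> d0 m0 [M [N [M0 _ XM]]] /XM[h [_ h0 hM]].
have dR : (0 : R) < d%:R by rewrite ltr0n.
have /choice[Kf HK] : forall i, exists K, 0 <= K /\
    forall t, 0 <= t <= 1 -> `|(h i).[t] - (h i).[0]| <= K * t.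
  by move=> i; have [K K0 HK] := poly_lipschitz01 (h i); exists K.
pose K : R := \sum_(i < d) Kf i.
have K0 : 0 <= K by apply: sumr_ge0 => i _; case: (HK i).
have r0 : 0 < M / d%:R by rewrite divr_gt0.
(* The radius is at most [M / d%:R * t], since [t <= 1] and [0 < m]; the other summand bounds the
   displacement of the curve from [x]. *)
exists (M / d%:R), (M / d%:R + K); split => //; first by rewrite ltr_wpDr.
move=> t /andP[t0 t1]; have t01 : 0 <= t <= 1 by rewrite (ltW t0).
set s := _ * t ^+ m; pose a := poly_curve h t; exists a.
have Xs p : `|p - a| < s -> X p.
  move=> pa; apply: contrapT => nXp.
  have : ((M * t `^ m%:R)%:E <= (enorm (a - p))%:E)%E.
    apply: le_trans (hM t t01) _.
    by apply: ereal_inf_lbound; exists p.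
  rewrite lee_fin powR_mulrn ?(ltW t0)// leNgt => /negP; apply.
  apply: le_lt_trans (enorm_le_norm _) _; rewrite distrC mulrC -ltr_pdivlMr//.
  by rewrite mulrAC.
move=> p pa; split.
  apply/nbhs_ballP; exists (s - `|p - a|); first by rewrite /= subr_gt0.
  move=> q; rewrite -ball_normE/= => pq; apply: Xs.
  apply: le_lt_trans (ler_distD p q a) _.
  by rewrite distrC -ltrBrDr.
apply: le_trans (ler_distD a p x) _; rewrite mulrDl lerD//.
  apply: le_trans (ltW pa) _; rewrite /s ler_wpM2l ?(ltW r0)//.
  by rewrite ler_iXnr// ?(ltW t0).
apply: norm_le_coord => [|i]; first by rewrite mulr_ge0// ltW.
rewrite -h0 !mxE; have [_ /(_ t t01)/le_trans] := HK i; apply.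
rewrite ler_wpM2r ?(ltW t0)// /K (bigD1 i)//= lerDl sumr_ge0// => k _.
by case: (HK k).
Qed.

(** The limit is over a punctured neighbourhood, so nothing is obtained about [f x] itself. *)
Lemma weakly_flat_bound (X : set V) (k : nat) (f : V -> R) (x : V) (e : R) :
    weakly_flat X k%:R f x -> 0 < e ->
  exists2 del, 0 < del & forall y, X y -> y != x -> `|y - x| < del ->
    `|f y| <= e * enorm (y - x) ^+ k.
Proof.
move=> /cvgrPdist_le fx e0.
have /nbhs_ballP[del /= del0 H] := fx _ e0; exists del => // y Xy yx yd.
have : ball x del y by rewrite -ball_normE /= distrC.
move=> /H /(_ yx Xy); rewrite sub0r normrN powR_mulrn ?enorm_ge0//.
have E0 : 0 < enorm (y - x) ^+ k.
  by rewrite exprn_gt0// (lt_le_trans _ (norm_le_enorm _))// normr_gt0 subr_eq0.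
by rewrite normrM normr_id normfV (gtr0_norm E0) ler_pdivrMr.
Qed.

Lemma extended_derivatives_continuous (X : set V) n f F j (x : V) v (e : R) :
    extended_derivatives X n f F -> (j <= n)%N -> X x -> 0 < e ->
  exists2 del, 0 < del & forall y, X y -> `|y - x| < del ->
    `|F j y v - F j x v| <= e.
Proof.
move=> [_ _ _ Fc] jn Xx e0; pose P := \prod_(i < j) enorm (v i).
have P0 : 0 <= P by apply: prodr_ge0 => i _; exact: enorm_ge0.
have P1 : 0 < P + 1 by rewrite ltr_wpDl.
have /nbhs_ballP[del /= del0 H] := Fc j x jn Xx _ (divr_gt0 e0 P1).
exists del => // y Xy yd.
have : ball x del y by rewrite -ball_normE /= distrC.
move=> /H /(_ Xy v)/le_trans; apply.
by rewrite -/P mulrAC ler_pdivrMr// ler_wpM2l ?ltW// ltrDl.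
Qed.

(** The mixed difference of [f] at the centre with steps [v i] is at most $2^j b$ in absolute value,
    and it equals a value of the [j]-th derivative at [v]. *)
Lemma derivative_value_bound (X : set V) n f F (a : V) (r b : R) j
    (v : 'I_j -> V) :
    extended_derivatives X n f F -> (j <= n)%N ->
    (forall p, `|p - a| < r -> X° p /\ `|f p| <= b) ->
    \sum_(i < j) `|v i| < r ->
  exists2 z, `|z - a| < r & `|F j z v| <= 2 ^+ j * b.
Proof.
move=> [F0 Fm Fd _] jn ball_r vr.
have [s [sj ss sF]] := args_as_seq v.
(* One family for all orders: differentiating [G s] in direction [t] prepends [t] to [s]. *)
pose G (s : seq V) z := F (size s) z (@seq_args R d s).
have dG u t z : (size u < n)%N -> `|z - a| < r ->
    is_derive z t (G u) (G (t :: u) z).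
  move=> un /ball_r[zX _]; rewrite /G seq_args_cons.
  apply: frechet_is_derive; first exact: Fd.
  by apply: Fm => //; exact: interior_subset.
(* Reversed steps, because the mean value theorem returns the arguments in reverse order. *)
have sr : fits a r a (rev s).
  by rewrite /fits subrr normr0 add0r (perm_big s) ?perm_rev//= ss.
have szr : (size (rev s) + size (Nil V) <= n)%N by rewrite size_rev sj addn0.
have [z za E] := mixed_diff_mvt (fun s u z => dG s u z) szr sr.
exists z => //; rewrite sF -/(G s z).
have -> : G s z = mixed_diff (rev s) (G [::]) a by rewrite E catrevE revK cats0.
rewrite -sj -(size_rev s); apply: mixed_diff_bound sr => p /ball_r[pX fb].
by rewrite /G F0//; exact: interior_subset.
Qed.

End Cusps.

(** * Choice of the scale and vanishing of the derivatives *)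

Lemma p_index_inv (R : realType) (m : nat) : p_index (m%:R^-1 : R) = (2 * m)%N.
Proof.
by rewrite /p_index invrK -natrM -[(2 * m)%:R]/((2 * m)%:Z%:~R) intrKceil.
Qed.

Lemma cusp_scale (R : realType) (K del : R) : 0 < K -> 0 < del ->
  exists2 t : R, 0 < t <= 1 & K * t < del.
Proof.
move=> K0 del0; have Kd : 0 < K + del by rewrite addr_gt0.
exists (del / (K + del)).
  by rewrite divr_gt0// ler_pdivrMr// mul1r lerDr ltW.
by rewrite mulrA ltr_pdivrMr// mulrC ltr_pM2l// ltrDl.
Qed.

(** Supplies the points along which flatness and continuity force [f x = 0]. The centre of a small
    cusp ball works unless it is [x]; then the shifted point [b] does, as [0 < d]. *)
Lemma UPC_not_isolated (R : realType) (d : nat) (X : set 'rV[R]_d) (m : nat)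
    (x : 'rV[R]_d) (del : R) :
    (0 < d)%N -> (0 < m)%N -> UPC_exponent X m%:R -> X x -> 0 < del ->
  exists y, [/\ X y, y != x & `|y - x| < del].
Proof.
move=> d0 m0 XM Xx del0; have [r [K [r0 K0 H]]] := UPC_cusp d0 m0 XM Xx.
have [t t01 Kt] := cusp_scale K0 del0; have [a aP] := H t t01.
have s0 : 0 < r * t ^+ m.
  by case/andP: t01 => t0 _; rewrite mulr_gt0// exprn_gt0.
pose s := r * t ^+ m; pose b := a + const_mx (s / 2).
have near_a p : `|p - a| < s -> p != x ->
    exists y, [/\ X y, y != x & `|y - x| < del].
  move=> /aP[pX px] nx; exists p; split => //; first exact: interior_subset.
  exact: le_lt_trans px Kt.
have [ax|] := eqVneq a x; last by apply: near_a; rewrite subrr normr0.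
have sb : `|b - a| < s.
  apply: (@le_lt_trans _ _ (s / 2)); last by rewrite /s; lra.
  apply: norm_le_coord => [|i]; first by rewrite divr_ge0// ltW.
  by rewrite !mxE addrAC subrr add0r ger0_norm// divr_ge0// ltW.
apply: (near_a b) => //; apply/eqP.
move=> /(congr1 (fun u : 'rV[R]_d => u ord0 (Ordinal d0))).
by rewrite -ax !mxE; move: s0; rewrite -/s; lra.
Qed.

Theorem corollary6p6 (R : realType) (d : nat) (hd : (0 < d)%N)
    (X : set 'rV[R]_d) (hX : UPC X)
    (alpha : R) (halpha : UPC_index X alpha)
    (x : 'rV[R]_d) (hx : X x) (n : nat)
    (omega : R -> R) (homega : modulus_of_continuity omega)
    (f : 'rV[R]_d -> R)
    (hfA : Akomega X (n * p_index alpha)%N omega f)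
    (hfC : Cn X n f)
    (hflat : weakly_flat X ((n * p_index alpha)%:R / 2) f x) :
  flat X n f x.
Proof.
have [m [m0 am XM]] := halpha.
pose k := (n * m)%N.
(* As $p(\alpha) = 2m$, the flatness order is the natural number $k = nm$. *)
have fxk : weakly_flat X k%:R f x.
  suff -> : (k%:R : R) = (n * p_index alpha)%:R / 2 by [].
  by rewrite am p_index_inv mulnCA [in RHS]natrM mulrAC mulfV ?mul1r.
move=> F dF j jn v.
(* Needed separately, as the cusp balls used below may contain [x]. *)
have fx0 : f x = 0.
  apply/eqP; rewrite -normr_le0; apply/ler_addgt0Pr => e e0; rewrite add0r.
  have e2 : 0 < e / 2 by lra.
  have [del1 del10 H1] := weakly_flat_bound fxk e2.
  have [del2 del20 H2] :=
    extended_derivatives_continuous (fun=> 0) dF (leq0n n) hx e2.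
  have dR : (0 : R) < d%:R by rewrite ltr0n.
  (* The bound [d%:R^-1] makes [enorm (y - x)] at most 1, and so its [k]-th power, even for
     [k = 0]. *)
  pose del := Num.min (Num.min del1 del2) d%:R^-1.
  have del0 : 0 < del by rewrite !lt_min del10 del20 invr_gt0.
  have [y [Xy yx]] := UPC_not_isolated hd m0 XM hx del0.
  rewrite !lt_min => /andP[/andP[y1 y2] y3].
  have := H2 y Xy y2; case: (dF) => F0 _ _ _; rewrite !F0// => fyx.
  have fy : `|f y| <= e / 2.
    apply: le_trans (H1 y Xy yx y1) _; rewrite ler_piMr ?(ltW e2)//.
    rewrite exprn_ile1 ?enorm_ge0//; apply: le_trans (enorm_le_norm _) _.
    by rewrite mulrC -ler_pdivlMr// mul1r ltW.
  have := ler_normB (f y) (f y - f x); rewrite opprB addrC subrK.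
  by lra.
apply/eqP; rewrite -normr_le0; apply/ler_addgt0Pr => e e0; rewrite add0r.
have [r [K [r0 K0 cusp]]] := UPC_cusp hd m0 XM hx.
(* The summand 1 makes [L] positive and the total length of the scaled steps strictly less than the
   radius. *)
pose L : R := \sum_(i < j) `|v i| + 1.
have L0 : 0 < L by rewrite ltr_wpDl// sumr_ge0.
pose lam := r / L.
have lam0 : 0 < lam by rewrite divr_gt0.
(* The factors come from the terms of the mixed difference, from [enorm (p - x) <= d%:R * K * t],
   and from homogeneity in the [j] steps. *)
pose C : R := 2 ^+ j * (d%:R * K) ^+ k / lam ^+ j.
have dK0 : 0 <= d%:R * K by rewrite mulr_ge0// ltW.
have C0 : 0 <= C.
  by rewrite /C divr_ge0// ?mulr_ge0// exprn_ge0// ltW.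
have C1 : 0 < C + 1 by rewrite ltr_wpDl.
have e2 : 0 < e / 2 by lra.
pose eps := e / 2 / (C + 1).
have eps0 : 0 < eps by rewrite divr_gt0.
have [del1 del10 H1] := weakly_flat_bound fxk eps0.
have [del2 del20 H2] := extended_derivatives_continuous v dF jn hx e2.
have del0 : 0 < Num.min del1 del2 by rewrite lt_min del10.
have [t /[dup] t01 /andP[t0 t1] Kt] := cusp_scale K0 del0.
have [a aP] := cusp t t01.
pose rho := t ^+ m.
have rho0 : 0 < rho by rewrite exprn_gt0.
have ball_a p : `|p - a| < r * rho ->
    X° p /\ `|f p| <= eps * ((d%:R * K) ^+ k * rho ^+ n).
  move=> /aP[pX px]; split => //.
  have [->|nx] := eqVneq p x.
    rewrite fx0 normr0; apply: mulr_ge0; first exact: ltW.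
    by apply: mulr_ge0; apply: exprn_ge0 => //; exact: ltW.
  have p1 : `|p - x| < del1.
    by apply: le_lt_trans px _; move: Kt; rewrite lt_min => /andP[].
  apply: le_trans (H1 p (interior_subset pX) nx p1) _.
  rewrite ler_wpM2l ?(ltW eps0)// /rho -exprM mulnC -exprMn.
  rewrite lerXn2r ?nnegrE ?enorm_ge0//.
    by rewrite mulr_ge0// ltW.
  by apply: le_trans (enorm_le_norm _) _; rewrite -mulrA ler_wpM2l.
have lr0 : 0 < lam * rho by rewrite mulr_gt0.
have vr : \sum_(i < j) `|(lam * rho) *: v i| < r * rho.
  under eq_bigr do rewrite normrZ (gtr0_norm lr0).
  rewrite -mulr_sumr mulrAC ltr_pM2r// /lam mulrAC ltr_pdivrMr// ltr_pM2l//.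
  by rewrite ltrDl.
have [z za] := derivative_value_bound dF jn ball_a vr.
have [zX zx] := aP z za; have Xz := interior_subset zX.
have [_ Fm _ _] := dF.
rewrite multilinear_scale; last exact: Fm.
rewrite normrM normrX (gtr0_norm lr0) exprMn => Fz.
have Fz2 : `|F j z v| <= e / 2.
  (* Here [j <= n] and [rho <= 1] enter: [rho ^+ j] then cancels, leaving a bound independent of
     [t]. *)
  have rhonj : rho ^+ n <= rho ^+ j.
    apply: ler_wiXn2l => //; first exact: ltW.
    by apply: exprn_ile1 => //; exact: ltW.
  have lamj : 0 < lam ^+ j by rewrite exprn_gt0.
  have rhoj : 0 < rho ^+ j by rewrite exprn_gt0.
  have : lam ^+ j * rho ^+ j * `|F j z v| <= lam ^+ j * rho ^+ j * (eps * C).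
    apply: le_trans Fz _.
    have -> : lam ^+ j * rho ^+ j * (eps * C) =
        2 ^+ j * (eps * ((d%:R * K) ^+ k * rho ^+ j)).
      by rewrite /C; field; rewrite gt_eqF.
    do 3?[apply: ler_wpM2l; first by rewrite ?exprn_ge0// ltW].
    exact: rhonj.
  rewrite ler_pM2l ?mulr_gt0// => /le_trans; apply.
  by rewrite /eps mulrAC ler_pdivrMr// ler_wpM2l ?ltW// ltrDl.
have z2 : `|z - x| < del2.
  by apply: le_lt_trans zx _; move: Kt; rewrite lt_min => /andP[].
(* The value at [z] and the change from [z] to [x] each account for [e / 2]. *)
have := H2 z Xz z2; have := ler_normB (F j z v) (F j z v - F j x v).
rewrite opprB addrC subrK; lra.
Qed.
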